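(* Let $H_{3,6}$ denote the Heawood graph. For any cubic graph $G$ of girth at least $5$ and every $\lambda>0$, \[ \alpha_G(\lambda) \le \alpha_{H_{3,6}}(\lambda), \] where $\alpha_G(\lambda)$ denotes the occupancy fraction of the hard-core model on $G$ at fugacity $\lambda$. Moreover (for each $\lambda>0$) equality holds if and only if $G$ is a disjoint union of copies of $H_{3,6}$.
   Context: All graphs are finite, simple and non-empty. A graph is cubic if it is $3$-regular. Girth at least $5$ means that the graph contains no cycle of length $3$ or $4$. Let $\mathcal I(G)$ be the set of all independent sets of $G$ (including the empty set). The independence polynomial of $G$ is $P_G(\lambda)=\sum_{I\in\mathcal I(G)}\lambda^{|I|}$. For $\lambda>0$, the hard-core model on $G$ at fugacity $\lambda$ is the probability distribution on $\mathcal I(G)$ given by $\Pr[I]=\lambda^{|I|}/P_G(\lambda)$. The occupancy fraction is \[ \alpha_G(\lambda)=\frac{1}{|V(G)|}\,\mathbb E|I|=\frac{\lambda P_G'(\lambda)}{|V(G)|\,P_G(\lambda)}, \] where $I$ is drawn from the hard-core model. The Heawood graph $H_{3,6}$ is the point-line incidence graph of the Fano plane (a $3$-regular, vertex-transitive graph on $14$ vertices of girth $6$). ''$G$ is a (disjoint) union of copies of $H$'' means that every connected component of $G$ is isomorphic to $H$. *)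

(* Defs.v *)
From HB Require Import structures.
From mathcomp Require Import all_boot all_order all_algebra.
From mathcomp Require Import reals.

Set Implicit Arguments.
Unset Strict Implicit.
Unset Printing Implicit Defensive.

Import Order.TTheory GRing.Theory Num.Theory.
Local Open Scope ring_scope.

Record sgraph := SGraph {
  vertex :> finType;
  edge : rel vertex;
  edge_sym : symmetric edge;
  edge_irrefl : irreflexive edge
}.

Definition regular (k : nat) (G : sgraph) : Prop :=
  forall x : G, #|[set y : G | edge x y]| = k.

Definition cubic (G : sgraph) : Prop := regular 3 G.

(* A cycle of length k >= 3 is listed by its vertices, without repetition, in
   cyclic order. *)
Definition has_cycle (G : sgraph) (k : nat) : Prop :=
  exists2 c : seq G, ucycle (@edge G) c & size c = k.

Definition girth_ge5 (G : sgraph) : Prop :=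
  ~ has_cycle G 3 /\ ~ has_cycle G 4.

Definition independent (G : sgraph) : {set {set G}} :=
  [set I : {set G} | [forall x in I, forall y in I, ~~ edge x y]].

Definition indep_poly (R : realType) (G : sgraph) : {poly R} :=
  \sum_(I in independent G) 'X^#|I|.

Definition hardcore (R : realType) (G : sgraph) (lambda : R) (I : {set G}) : R :=
  if I \in independent G then lambda ^+ #|I| / (indep_poly R G).[lambda] else 0.

Definition occupancy (R : realType) (G : sgraph) (lambda : R) : R :=
  (\sum_(I : {set G}) hardcore lambda I * #|I|%:R) / #|G|%:R.

Lemma occupancyE (R : realType) (G : sgraph) (lambda : R) :
  occupancy G lambda =
  lambda * (indep_poly R G)^`().[lambda] / (#|G|%:R * (indep_poly R G).[lambda]).
Proof.
rewrite /occupancy /hardcore [_ * (indep_poly _ _).[_]]mulrC invfM mulrA.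
congr (_ / _); rewrite (bigID (mem (independent G))) /=.
rewrite [X in _ + X]big1 ?addr0 => [|I /negbTE->]; last by rewrite mul0r.
move: (indep_poly R G).[lambda] => Z.
rewrite /indep_poly linear_sum horner_sum mulr_sumr mulr_suml.
apply: eq_bigr => I -> /=; rewrite derivXn hornerMn hornerXn mulrAC.
congr (_ / _); case: #|I| => [|n]; first by rewrite !mulr0.
by rewrite /= mulr_natr mulrnAr -exprS.
Qed.

Definition isomorphic (G H : sgraph) : Prop :=
  exists2 f : G -> H, bijective f & forall x y, edge (f x) (f y) = edge x y.

Section Induced.
Variables (G : sgraph) (A : {set G}).

Definition induced_edge : rel {x : G | x \in A} :=
  fun x y => edge (val x) (val y).

Lemma induced_edge_sym : symmetric induced_edge.
Proof. by move=> x y; apply: edge_sym. Qed.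

Lemma induced_edge_irrefl : irreflexive induced_edge.
Proof. by move=> x; apply: edge_irrefl. Qed.

Definition induced : sgraph := SGraph induced_edge_sym induced_edge_irrefl.
End Induced.

Definition component (G : sgraph) (x : G) : sgraph :=
  induced [set y : G | connect (@edge G) x y].

Definition union_of_copies (H G : sgraph) : Prop :=
  forall x : G, isomorphic (component x) H.

(* The Fano plane in its cyclic model: the lines are the seven translates of
   the perfect difference set {0, 1, 3} in Z/7. *)
Definition fano_line (l : 'Z_7) : {set 'Z_7} := [set l; l + 1; l + 3].

Definition heawood_edge : rel ('Z_7 + 'Z_7) := fun u v =>
  match u, v with
  | inl p, inr l => p \in fano_line l
  | inr l, inl p => p \in fano_line l
  | _, _ => false
  end.

Lemma heawood_edge_sym : symmetric heawood_edge.
Proof. by case=> u [] v. Qed.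

Lemma heawood_edge_irrefl : irreflexive heawood_edge.
Proof. by case. Qed.

Definition heawood : sgraph := SGraph heawood_edge_sym heawood_edge_irrefl.

Lemma card_fano_line (l : 'Z_7) : #|fano_line l| = 3.
Proof.
rewrite /fano_line setUC cardsU1 cards2 !inE.
by move: l; case; do 7![case=> [//|]].
Qed.

Lemma fano_line_through (p q : 'Z_7) : p != q ->
  #|[set l | (p \in fano_line l) && (q \in fano_line l)]| = 1.
Proof.
rewrite -sum1_card big_mkcond !big_ord_recl big_ord0 /fano_line !inE.
by case: p => [[|[|[|[|[|[|[|?]]]]]]] ?] //;
  case: q => [[|[|[|[|[|[|[|?]]]]]]] ?].
Qed.

(* Main.v *)
(* A linear-programming duality argument. Let n(x) be the number of occupied
   neighbours of x. Since every vertex has three neighbours, for any function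
   M the local quantity 3 M(n(v)) - sum_(u ~ v) M(n(u)) sums to zero over all v.
   With a suitable M (depending on lambda), the local score
     3 D [v in I] + 3 M(n(v)) - sum_(u ~ v) M(n(u)) - 3 C
   has nonpositive conditional expectation given the restriction of I to the
   complement of the ball of radius 2 around v; summing over v gives
   occupancy <= C / D. By the girth condition this ball is a tree with six leaves
   plus matchings between the three pairs of leaves, so the conditional
   expectation depends only on these matchings and on the set of leaves not
   blocked from outside. The finitely many resulting polynomials in lambda have
   coefficients of constant sign.
   Conditioning on the empty set and on a single vertex at distance 3 gives strict
   inequality unless there are no edges between leaves and every vertex at
   distance 3 has one neighbour in each pair of leaves; these two properties
   determine the component of v to be the Heawood graph. In the Heawood graph every local
   view is tight, so that its occupancy fraction is C / D. *)
Require Import Defs.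
From Stdlib Require Import ZArith.
From mathcomp Require Import all_boot all_order all_algebra.
From mathcomp Require Import reals.
From mathcomp Require Import ssrZ ring.

Set Implicit Arguments.
Unset Strict Implicit.
Unset Printing Implicit Defensive.

Import Order.TTheory GRing.Theory Num.Theory.
Local Open Scope ring_scope.

(** * Integer polynomials as coefficient lists, constant term first *)

Section ListPoly.

Fixpoint addp (p q : seq Z) : seq Z :=
  match p, q with
  | [::], _ => q
  | _, [::] => p
  | a :: p', b :: q' => Z.add a b :: addp p' q'
  end.

Definition oppp : seq Z -> seq Z := map Z.opp.
Definition sump : seq (seq Z) -> seq Z := foldr addp [::].
Definition shiftp (n : nat) (p : seq Z) : seq Z := ncons n Z0 p.

Variables (R : realFieldType) (x : R).

(** Horner evaluation. The coefficients are binary integers, so that the list arithmetic can be run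
    by [vm_compute]. *)
Definition evalp (p : seq Z) : R :=
  foldr (fun c s => (int_of_Z c)%:~R + x * s) 0 p.

Lemma evalp_add p q : evalp (addp p q) = evalp p + evalp q.
Proof.
elim: p q => [|a p IH] [|b q] //=; rewrite ?add0r ?addr0 //.
rewrite IH (raddfD int_of_Z a b) intrD mulrDr !addrA; congr (_ + _).
by rewrite -!addrA; congr (_ + _); rewrite addrC.
Qed.

Lemma evalp_opp p : evalp (oppp p) = - evalp p.
Proof.
elim: p => [|a p IH] /=; first by rewrite oppr0.
by rewrite IH (raddfN int_of_Z a) intrN mulrN opprD.
Qed.

Lemma evalp_sum s : evalp (sump s) = \sum_(p <- s) evalp p.
Proof.
by elim: s => [|p s IH] /=; rewrite ?big_nil // big_cons evalp_add IH.
Qed.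

Lemma evalp_shift n p : evalp (shiftp n p) = x ^+ n * evalp p.
Proof.
by elim: n => [|n IH] /=; rewrite ?expr0 ?mul1r // IH add0r mulrA -exprS.
Qed.

Lemma evalp_null p : all (Z.eqb Z0) p -> evalp p = 0.
Proof.
by elim: p => //= -[] //= p IH /IH ->; rewrite mulr0 addr0.
Qed.

Lemma evalp_if (b : bool) p : evalp (if b then p else [::]) = evalp p *+ b.
Proof. by case: b. Qed.

Hypothesis x_gt0 : 0 < x.

Lemma evalp_ge0 p : all (Z.leb Z0) p -> 0 <= evalp p.
Proof.
elim: p => //= a p IH /andP[a_ge0 /IH p_ge0].
by rewrite addr_ge0 ?mulr_ge0 ?(ltW x_gt0) // ler0z; case: a a_ge0.
Qed.

Lemma evalp_gt0 p : all (Z.leb Z0) p -> has (Z.ltb Z0) p -> 0 < evalp p.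
Proof.
elim: p => //= a p IH /andP[a_ge0 p_ge0] /orP[a_gt0|/IH p_gt0].
  rewrite ltr_wpDr ?mulr_ge0 ?(ltW x_gt0) ?evalp_ge0 // ltr0z.
  case: a a_gt0 {a_ge0} => // a _ /=.
  by rewrite ltz_nat; apply/ssrnat.ltP/Pos2Nat.is_pos.
by rewrite ltr_wpDl ?mulr_gt0 ?p_gt0 // ler0z; case: a a_ge0.
Qed.

End ListPoly.

Arguments evalp : simpl never.

(* D, C and M are the polynomials [unitp], [valuep] and [weightp t]. Up to scaling
   they are the unique solution, with M(0) = 0, of the linear equations saying
   that the four local views occurring in the Heawood graph are tight: no edge
   between leaves, and (2,2,2), (1,1,1), (1,0,0) or (0,0,0) unblocked leaves in
   the three pairs. *)
Section DualSolution.
Local Open Scope Z_scope.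

Definition unitp : seq Z := [:: 2; 31; 183; 532; 826; 707; 343; 102; 20; 2].
Definition valuep : seq Z := [:: 0; 2; 23; 97; 193; 199; 114; 40; 9; 1].
Definition weightp (t : nat) : seq Z :=
  nth [::]
    [:: [::];
        [:: 0; 0; 3; 33; 104; 101; 6; -25; -7];
        [:: 0; 3; 27; 115; 272; 317; 173; 47; 8; 1];
        [:: -3; -27; -94; -139; -20; 139; 124; 45; 9; 1]] t.

End DualSolution.

(** * Local views as bit patterns, and the finite check *)

Section LocalViews.
Local Open Scope nat_scope.

Fixpoint masks (n : nat) : seq bitseq :=
  if n is n'.+1 then map (cons true) (masks n') ++ map (cons false) (masks n')
  else [:: [::]].

(* The score at v of a configuration in which v has state bv, its neighbours have
   states b0, b1, b2, and j0, j1, j2 leaves are occupied below these neighbours. *)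
Definition scorep (bv b0 b1 b2 : bool) (j0 j1 j2 : nat) : seq Z :=
  let triple p := sump [:: p; p; p] in
  sump [:: if bv then triple unitp else [::];
           triple (weightp (b0 + b1 + b2));
           oppp (weightp (bv + j0));
           oppp (weightp (bv + j1));
           oppp (weightp (bv + j2));
           oppp (triple valuep)].

(** Independence of the state of v and its neighbours, given the occupied leaves. Two neighbours of
    v are never adjacent, since there are no triangles. *)
Definition core_ok (bv b0 b1 b2 : bool) (j0 j1 j2 : nat) : bool :=
  [&& bv ==> ~~ [|| b0, b1 | b2],
      b0 ==> (j0 == 0), b1 ==> (j1 == 0) & b2 ==> (j2 == 0)].

(** The score summed over the admissible states of v and its neighbours; [shiftp] supplies the power
    of lambda that weights each state. *)
Definition core_sum (j0 j1 j2 : nat) : seq Z :=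
  sump [seq let: b := nth false m in
            shiftp (count id m) (scorep (b 0) (b 1) (b 2) (b 3) j0 j1 j2)
       | m <- masks 4 &
         core_ok (nth false m 0) (nth false m 1) (nth false m 2)
                 (nth false m 3) j0 j1 j2].

(* Tabulated so that [all_views_ok] computes each of the 27 polynomials once. *)
Definition core_table : seq (seq (seq (seq Z))) := Eval vm_compute in
  [seq [seq [seq core_sum j0 j1 j2 | j2 <- iota 0 3] | j1 <- iota 0 3] | j0 <- iota 0 3].

Definition core_lookup (j0 j1 j2 : nat) : seq Z :=
  nth [::] (nth [::] (nth [::] core_table j0) j1) j2.

Lemma core_lookupE j0 j1 j2 : (j0 < 3) -> (j1 < 3) -> (j2 < 3) ->
  core_lookup j0 j1 j2 = core_sum j0 j1 j2.
Proof.
by case: j0 => [|[|[|//]]] _; case: j1 => [|[|[|//]]] _; case: j2 => [|[|[|//]]] _; vm_compute.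
Qed.

(* Leaves 0 to 5, where the leaves 2i and 2i+1 are attached to the i-th neighbour
   of v. A local view consists of six bits u, telling which leaves have no
   occupied neighbour outside the ball, and of twelve bits e, telling which of
   the [cross_pairs] are edges. *)
Definition cross_pairs01 := [:: (0, 2); (0, 3); (1, 2); (1, 3)].
Definition cross_pairs02 := [:: (0, 4); (0, 5); (1, 4); (1, 5)].
Definition cross_pairs12 := [:: (2, 4); (2, 5); (3, 4); (3, 5)].
Definition cross_pairs := cross_pairs01 ++ cross_pairs02 ++ cross_pairs12.

(** Admissibility of the set [t] of occupied leaves. Two leaves below the same neighbour need no
    test: an edge between them would close a triangle. *)
Definition leaf_ok (u e t : bitseq) : bool :=
  all2 implb t u &&
  all (fun pe => ~~ [&& pe.2, nth false t pe.1.1 & nth false t pe.1.2])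
      (zip cross_pairs e).

(** The conditional expectation of the score given the outside of the ball, before normalisation, as
    a polynomial in lambda. *)
Definition view_sum (u e : bitseq) : seq Z :=
  sump [seq let: b := nth false t in
            shiftp (count id t)
              (core_lookup (b 0 + b 1) (b 2 + b 3) (b 4 + b 5))
       | t <- masks 6 & leaf_ok u e t].

(** The four bits stand for the edges pr, ps, qr, qs between leaf pairs {p,q} and {r,s}; no two
    chosen edges may share an endpoint. *)
Definition matching (a : bitseq) : bool :=
  let: b := nth false a in
  [&& ~~ (b 0 && b 1), ~~ (b 2 && b 3), ~~ (b 0 && b 2) & ~~ (b 1 && b 3)].

Definition edges_within (u : bitseq) (ps : seq (nat * nat)) (a : bitseq) : bool :=
  all (fun pe => pe.2 ==> nth false u pe.1.1 && nth false u pe.1.2) (zip ps a).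

(** The views occurring in the Heawood graph, with (1,0,0) in all three orders. *)
Definition tight_view (u e : bitseq) : bool :=
  let: b := nth false u in
  ~~ has id e &&
  ((b 0 + b 1, b 2 + b 3, b 4 + b 5) \in
     [:: (2, 2, 2); (1, 1, 1); (1, 0, 0); (0, 1, 0); (0, 0, 1); (0, 0, 0)]).

(** The views to be excluded in the case of equality. The first branch arises from the empty set
    outside the ball, the second from a single outside vertex that blocks some leaf but misses a
    whole pair. *)
Definition strict_view (u e : bitseq) : bool :=
  let: b := nth false u in
  if all id u then has id e else
  [&& ~~ has id e, b 0 || b 1, b 2 || b 3, b 4 || b 5 &
      [|| b 0 && b 1, b 2 && b 3 | b 4 && b 5]].

Definition view_check (u e : bitseq) : bool :=
  let q := oppp (view_sum u e) in
  [&& all (Z.leb Z0) q, strict_view u e ==> has (Z.ltb Z0) q &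
      tight_view u e ==> all (Z.eqb Z0) q].

Definition local_edges (u : bitseq) (ps : seq (nat * nat)) : seq bitseq :=
  [seq a <- masks 4 | matching a && edges_within u ps a].

Definition all_views_check : bool :=
  all (fun u => let A01 := local_edges u cross_pairs01 in
                let A02 := local_edges u cross_pairs02 in
                let A12 := local_edges u cross_pairs12 in
     all (fun a => all (fun b => all (fun c => view_check u (a ++ b ++ c)) A12) A02) A01)
   (masks 6).

(** Two pairs of leaves admit at most 7 matchings, so each of the 64 patterns [u] has at most 343
    edge patterns. *)
Lemma all_views_ok : all_views_check.
Proof. by vm_compute. Qed.

End LocalViews.

(** * Sums over subsets and independent sets *)

Section Selection.
Variable T : finType.
Implicit Types (s : seq T) (A J : {set T}) (m : bitseq).

(** Selections are bit masks along a list, so that sums over them match the sums over [masks] in the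
    computed polynomials. *)
Definition with_selected J s m : {set T} := J :|: [set x in mask m s].

Lemma with_selected_cons J x s b m :
  with_selected J (x :: s) (b :: m) =
  if b then x |: with_selected J s m else with_selected J s m.
Proof.
rewrite /with_selected; case: b => //=.
by apply/setP => y; rewrite !inE orbCA.
Qed.

Lemma with_selected_nil J s : with_selected J s [::] = J.
Proof. by apply/setP => x; rewrite !inE mask0s orbF. Qed.

Lemma mem_masks n m : m \in masks n -> size m = n.
Proof.
elim: n m => [|n IH] m /=; first by rewrite inE => /eqP ->.
by rewrite mem_cat => /orP[] /mapP[m' /IH <- ->].
Qed.

Lemma masks_mem m : m \in masks (size m).
Proof.
elim: m => //= b m IH; rewrite mem_cat.
by case: b; rewrite map_f ?orbT.
Qed.

Lemma mem_with_selected J s m x : x \notin J ->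
  (x \in with_selected J s m) = (x \in mask m s).
Proof. by rewrite !inE => /negbTE->. Qed.

Lemma card_with_selected J s m A : uniq s -> [disjoint J & s] ->
  #|A :&: with_selected J s m| = (#|A :&: J| + count (mem A) (mask m s))%N.
Proof.
move=> s_uniq dis.
rewrite /with_selected setIUr cardsU.
have -> : (A :&: J) :&: (A :&: [set x in mask m s]) = set0.
  apply/setP => x; rewrite !inE; apply/negP => /andP[/andP[_ xJ] /andP[_ /mem_mask xs]].
  by rewrite (disjointFr dis xJ) in xs.
rewrite cards0 subn0 -size_filter; congr (_ + _)%N.
rewrite -(card_uniqP _) ?filter_uniq ?mask_uniq //.
by apply: eq_card => x; rewrite !inE mem_filter.
Qed.

Lemma sum_subsets_split1 (V : nmodType) x A (g : {set T} -> V) : x \in A ->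
  \sum_(I : {set T} | I \subset A) g I =
  \sum_(I : {set T} | I \subset A :\ x) (g (x |: I) + g I).
Proof.
move=> xA; rewrite big_split /= (bigID (fun I : {set T} => x \in I)) /=.
congr (_ + _); last by apply: eq_bigl => I; rewrite subsetD1.
rewrite (reindex_onto (fun I => x |: I) (fun I => I :\ x)) /=; last first.
  by move=> I /andP[_ xI]; rewrite setD1K.
apply: eq_bigl => I; rewrite setU11 andbT subUset sub1set xA /= subsetD1.
congr (_ && _); apply/eqP/idP => [<-|x_I]; last by rewrite setU1K.
by rewrite !inE eqxx.
Qed.

(** This is the conditioning on the part [J] outside [s]; it is used first for v with its
    neighbours, then for the leaves. *)
Lemma sum_subsets_split (V : nmodType) s A (g : {set T} -> V) :
  uniq s -> {subset s <= A} ->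
  \sum_(I : {set T} | I \subset A) g I =
  \sum_(J : {set T} | J \subset A :\: [set x in s])
    \sum_(m <- masks (size s)) g (with_selected J s m).
Proof.
elim: s A g => [|x s IH] A g /= => [_ _|/andP[x_s s_uniq] sA].
  apply: eq_big => [J|J _]; first by rewrite setD0.
  by rewrite big_seq1 /with_selected setU0.
rewrite (sum_subsets_split1 _ (sA x (mem_head _ _))).
rewrite (IH (A :\ x)) //; last first.
  move=> y ys; rewrite !inE sA ?inE ?ys ?orbT // andbT.
  by apply: contraNneq x_s => <-.
apply: eq_big => [J|J _].
  by rewrite setDDl; congr (_ \subset A :\: _); apply/setP => y; rewrite !inE.
rewrite big_cat !big_map /= big_split /=.
by congr (_ + _); apply: eq_bigr => m _; rewrite with_selected_cons.
Qed.

End Selection.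

Section Independence.
Variable G : sgraph.
Implicit Types (x y : G) (I J A : {set G}) (s : seq G).

Definition nbrs x : {set G} := [set y | edge x y].

Definition hits I x : nat := #|nbrs x :&: I|.

Lemma edge_nbrs x y : edge x y = (y \in nbrs x).
Proof. by rewrite inE. Qed.

Lemma edge_neq x y : edge x y -> x != y.
Proof. by apply: contraTneq => ->; rewrite edge_irrefl. Qed.

Lemma independentP I :
  reflect {in I &, forall x y, ~~ edge x y} (I \in independent G).
Proof.
rewrite inE; apply: (iffP forall_inP) => [H x y xI yI|H x xI].
  exact: (forall_inP (H x xI)).
by apply/forall_inP => y yI; apply: H.
Qed.

Lemma hits_eq0P I x : reflect {in I, forall y, ~~ edge x y} (hits I x == 0)%N.
Proof.
rewrite cards_eq0; apply: (iffP eqP) => [I0 y yI|H].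
  by apply/negP => xy; have := in_set0 y; rewrite -I0 !inE xy yI.
apply/setP => y; rewrite !inE; apply/negP => /andP[xy yI].
by rewrite (negbTE (H y yI)) in xy.
Qed.

Lemma independent_setU1 x I :
  (x |: I \in independent G) = (I \in independent G) && (hits I x == 0)%N.
Proof.
apply/independentP/andP => [H|[/independentP H /hits_eq0P Hx] y z].
  split; first by apply/independentP => y z yI zI; apply: H; rewrite !inE (yI, zI) orbT.
  by apply/hits_eq0P => y yI; apply: H; rewrite !inE ?eqxx ?yI ?orbT.
rewrite !inE => /orP[/eqP->|yI] /orP[/eqP->|zI].
- by rewrite edge_irrefl.
- exact: Hx.
- by rewrite edge_sym; apply: Hx.
- exact: H.
Qed.

Lemma independentS I J : I \subset J -> J \in independent G -> I \in independent G.
Proof.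
by move=> /subsetP sIJ /independentP H; apply/independentP => x y /sIJ xJ /sIJ; apply: H.
Qed.

Lemma independent_selected J x s b m :
  (with_selected J (x :: s) (b :: m) \in independent G) =
  (with_selected J s m \in independent G) &&
  (b ==> (hits (with_selected J s m) x == 0)%N).
Proof.
by rewrite with_selected_cons; case: b; rewrite ?independent_setU1 ?andbT.
Qed.

Lemma hits_selected J s m x : uniq s -> [disjoint J & s] ->
  hits (with_selected J s m) x = (hits J x + count (edge x) (mask m s))%N.
Proof.
move=> s_uniq dis; rewrite /hits card_with_selected //; congr (_ + _)%N.
by apply: eq_count => y; rewrite /= inE.
Qed.

(** Each selected vertex is tested against [J] and the later selected ones only, which suffices by
    symmetry. On a concrete list this unfolds to a boolean formula in the edges. *)
Fixpoint selectable J s m : bool :=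
  match s, m with
  | x :: s', b :: m' =>
    selectable J s' m' && (b ==> (hits J x + count (edge x) (mask m' s') == 0)%N)
  | _, _ => true
  end.

Lemma independent_with_selected J s m : uniq s -> [disjoint J & s] ->
  (with_selected J s m \in independent G) =
  (J \in independent G) && selectable J s m.
Proof.
elim: s m => [|x s IH] [|b m] /=; rewrite ?with_selected_nil ?andbT //.
  by move=> _ _; apply/f_equal2 => //; apply/setP => x; rewrite !inE orbF.
case/andP=> _ s_uniq; rewrite disjoint_sym disjoint_cons disjoint_sym => /andP[_ dis].
by rewrite independent_selected IH // hits_selected // andbA.
Qed.

Lemma hits_nbrs J x (s : seq G) :
  nbrs x =i s -> [disjoint J & s] -> hits J x = 0%N.
Proof.
move=> Nx dis; apply/eqP/hits_eq0P => y yJ; apply/negP => xy.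
by have := disjointFr dis yJ; rewrite -Nx inE xy.
Qed.

End Independence.

Lemma count_mask_cons (T : Type) (a : pred T) b m x s :
  count a (mask (b :: m) (x :: s)) = ((b && a x) + count a (mask m s))%N.
Proof. by case: b. Qed.

(** * Local scores, and conditioning outside v and its neighbours *)

Section LocalSums.
Variables (R : realFieldType) (G : sgraph) (lambda : R).
Implicit Types (x y v : G) (I J K : {set G}).

Let ev := evalp lambda.
Let wt t := ev (weightp t).

Definition score I v : R :=
  ev unitp *+ 3 *+ (v \in I) + wt (hits I v) *+ 3
  - \sum_(u in nbrs v) wt (hits I u) - ev valuep *+ 3.

(** The expected score at [v] times the independence polynomial at lambda, which avoids
    divisions. *)
Definition vertex_sum v : R :=
  \sum_(I in independent G) lambda ^+ #|I| * score I v.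

Lemma eval_scorep bv b0 b1 b2 j0 j1 j2 :
  ev (scorep bv b0 b1 b2 j0 j1 j2) =
  ev unitp *+ 3 *+ bv + wt (b0 + b1 + b2) *+ 3
  - (wt (bv + j0) + wt (bv + j1) + wt (bv + j2)) - ev valuep *+ 3.
Proof.
rewrite /wt /ev /scorep evalp_sum !big_cons big_nil.
rewrite evalp_if !evalp_opp !evalp_sum !big_cons !big_nil !addr0.
move: (evalp _ unitp) (evalp _ valuep) => a b.
move: (evalp _ (weightp _)) (evalp _ (weightp _)) (evalp _ (weightp _)) => c d e.
move: (evalp _ (weightp _)) => f.
by rewrite !mulrS !mulr0n !addr0 !opprD !addrA.
Qed.

Hypothesis no_triangle : forall x y z : G, edge x y -> edge x z -> ~~ edge y z.

Section Core.
Variables (v u0 u1 u2 : G).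
Hypothesis core_uniq : uniq [:: v; u0; u1; u2].
Hypothesis nbrs_v : nbrs v =i [:: u0; u1; u2].

Let core := [:: v; u0; u1; u2].

(** Once the set [K] outside v and its neighbours is fixed, the score depends only on how many
    occupied leaves lie below each neighbour. *)
Lemma vertex_sum_core :
  vertex_sum v =
  \sum_(K : {set G} | (K \subset ~: [set x in core]) && (K \in independent G))
    lambda ^+ #|K| * ev (core_sum (hits K u0) (hits K u1) (hits K u2)).
Proof.
rewrite /vertex_sum big_mkcond /=.
rewrite (eq_bigl (fun I : {set G} => I \subset setT)); last by move=> I; rewrite subsetT.
rewrite (sum_subsets_split _ core_uniq); last by move=> x; rewrite !inE.
rewrite setTD -/core big_mkcondr; apply: eq_bigr => K sK.
have dis : [disjoint K & core].
  rewrite disjoint_subset; apply/subsetP => x xK.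
  by have := subsetP sK _ xK; rewrite in_setC in_set.
have notK x : x \in core -> x \notin K by move=> xc; rewrite (disjointFl dis xc).
have E0 : edge v u0 by have := nbrs_v u0; rewrite !inE eqxx.
have E1 : edge v u1 by have := nbrs_v u1; rewrite !inE eqxx ?orbT.
have E2 : edge v u2 by have := nbrs_v u2; rewrite !inE eqxx ?orbT.
have F01 : edge u0 u1 = false by apply/negbTE/(no_triangle E0 E1).
have F02 : edge u0 u2 = false by apply/negbTE/(no_triangle E0 E2).
have F12 : edge u1 u2 = false by apply/negbTE/(no_triangle E1 E2).
have Kv : hits K v = 0%N.
  apply: hits_nbrs nbrs_v _; apply: disjointWr dis.
  by apply/subsetP => x xs; rewrite inE xs orbT.
have u_uniq : uniq [:: u0; u1; u2] by case/andP: core_uniq.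
(* If [K] is not independent, no extension of it is, and both sides vanish. *)
case: ifP => indK; last first.
  rewrite big1_seq // => m _; rewrite ifF //; apply: contraFF indK.
  by apply: independentS; rewrite subsetUl.
rewrite /core_sum /ev evalp_sum big_map big_filter mulr_sumr [RHS]big_mkcond.
have -> : size core = 4%N by [].
rewrite big_seq [RHS]big_seq; apply: eq_bigr => m /mem_masks.
case: m => [//|bv [//|b0 [//|b1 [//|b2 [|//]]]]] _ /=.
rewrite evalp_shift -/ev eval_scorep.
set m := [:: bv; b0; b1; b2]; set I := with_selected K core m.
have -> : #|I| = (#|K| + count id m)%N.
  rewrite -[I]setTI card_with_selected // setTI; congr (_ + _)%N.
  rewrite (eq_count (a2 := predT)) => [|x]; last by rewrite /= inE.
  by rewrite count_predT size_mask.
have -> : (I \in independent G) =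
    core_ok bv b0 b1 b2 (hits K u0) (hits K u1) (hits K u2).
  rewrite independent_with_selected // indK /core /m; cbn [selectable].
  rewrite !count_mask_cons /=.
  rewrite Kv E0 E1 E2 F01 F02 F12.
  rewrite /core_ok !andbF !addn0.
  by move: (hits K u0 == _)%N (hits K u1 == _)%N (hits K u2 == _)%N => [] [] [];
    case: (bv) (b0) (b1) (b2) => [] [] [] [].
have hitsI x : hits I x = (hits K x + ((bv && edge x v) + ((b0 && edge x u0) +
    ((b1 && edge x u1) + (b2 && edge x u2)))))%N.
  by rewrite hits_selected // !count_mask_cons /= addn0.
case: ifP => [ok|//].
rewrite exprD mulrA /score; congr (_ * (_ *+ _ *+ _ + wt _ *+ _ - _ - _)).
- congr nat_of_bool; rewrite mem_with_selected ?notK ?mem_head // /m /core.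
  case/andP: core_uniq => v_u _; case: (bv); first exact: mem_head.
  rewrite -[LHS]/(v \in mask [:: b0; b1; b2] [:: u0; u1; u2]).
  by apply/negbTE; apply: contra v_u => /mem_mask.
- by rewrite hitsI Kv edge_irrefl E0 E1 E2 andbF !andbT !add0n addnA.
rewrite (eq_bigl (mem [:: u0; u1; u2])) // -big_uniq //= !big_cons big_nil addr0 addrA.
rewrite !hitsI ![edge _ v]edge_sym E0 E1 E2 !edge_irrefl.
rewrite ![edge u1 u0]edge_sym ![edge u2 _]edge_sym F01 F02 F12.
by rewrite !andbF !andbT !addn0 ![(bv + _)%N]addnC.
Qed.

End Core.

End LocalSums.

(** * The ball of radius 2 *)

(** Distinctness of the ten vertices is what the girth condition provides. Edges between leaves of
    different pairs are left open. *)
Record ball (G : sgraph) (v : G) := Ball {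
  mid0 : G; mid1 : G; mid2 : G;
  leaf0 : G; leaf1 : G; leaf2 : G; leaf3 : G; leaf4 : G; leaf5 : G;
  ball_uniq : uniq [:: v; mid0; mid1; mid2; leaf0; leaf1; leaf2; leaf3; leaf4; leaf5];
  nbrs_root : nbrs v =i [:: mid0; mid1; mid2];
  nbrs_mid0 : nbrs mid0 =i [:: v; leaf0; leaf1];
  nbrs_mid1 : nbrs mid1 =i [:: v; leaf2; leaf3];
  nbrs_mid2 : nbrs mid2 =i [:: v; leaf4; leaf5]
}.

Definition leaves (G : sgraph) (v : G) (b : ball v) : seq G :=
  [:: leaf0 b; leaf1 b; leaf2 b; leaf3 b; leaf4 b; leaf5 b].
Definition ball_seq (G : sgraph) (v : G) (b : ball v) : seq G :=
  [:: v; mid0 b; mid1 b; mid2 b] ++ leaves b.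

(** Rewrites with all disequalities contained in [ball_uniq], in both orientations. *)
Ltac ball_distinct b :=
  have := ball_uniq b; rewrite /= !inE ?negb_or -!andbA;
  repeat (case/andP=> /negbTE; rewrite 1?eq_sym => ?); move=> _;
  repeat match goal with H : (?x == ?y) = false |- _ =>
    rewrite ?H ?[y == x]eq_sym ?H; clear H end.

Section View.
Variables (G : sgraph) (v : G) (b : ball v).

Definition free_leaves (J : {set G}) : bitseq :=
  [seq (hits J w == 0)%N | w <- leaves b].

(* Edges at a blocked leaf are irrelevant, and dropping them keeps the number of
   views to be checked small. *)
Definition free_edges (J : {set G}) : bitseq :=
  [seq [&& edge (nth v (leaves b) p.1) (nth v (leaves b) p.2),
           nth false (free_leaves J) p.1 & nth false (free_leaves J) p.2]
  | p <- cross_pairs].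

Lemma mid_edges :
  [seq edge (mid0 b) w | w <- leaves b] = [:: true; true; false; false; false; false] /\
  [seq edge (mid1 b) w | w <- leaves b] = [:: false; false; true; true; false; false] /\
  [seq edge (mid2 b) w | w <- leaves b] = [:: false; false; false; false; true; true].
Proof.
rewrite /leaves /= !edge_nbrs !nbrs_mid0 !nbrs_mid1 !nbrs_mid2 !inE !eqxx ?orbT.
by ball_distinct b.
Qed.

Variables (R : realFieldType) (lambda : R).

Hypothesis no_triangle : forall x y z : G, edge x y -> edge x z -> ~~ edge y z.

Lemma selectable_leaves J t : size t = 6 ->
  selectable J (leaves b) t = leaf_ok (free_leaves J) (free_edges J) t.
Proof.
have E01 : edge (leaf0 b) (leaf1 b) = false.
  by apply/negbTE/(@no_triangle (mid0 b)); have := nbrs_mid0 b;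
    [move=> /(_ (leaf0 b))|move=> /(_ (leaf1 b))]; rewrite !inE eqxx ?orbT.
have E23 : edge (leaf2 b) (leaf3 b) = false.
  by apply/negbTE/(@no_triangle (mid1 b)); have := nbrs_mid1 b;
    [move=> /(_ (leaf2 b))|move=> /(_ (leaf3 b))]; rewrite !inE eqxx ?orbT.
have E45 : edge (leaf4 b) (leaf5 b) = false.
  by apply/negbTE/(@no_triangle (mid2 b)); have := nbrs_mid2 b;
    [move=> /(_ (leaf4 b))|move=> /(_ (leaf5 b))]; rewrite !inE eqxx ?orbT.
case: t => [//|t0 [//|t1 [//|t2 [//|t3 [//|t4 [//|t5 [|//]]]]]]] _.
rewrite /leaves; cbn [selectable]; rewrite !count_mask_cons /leaf_ok.
rewrite /free_edges /free_leaves /cross_pairs /= E01 E23 E45.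
rewrite !andbF !addn0 !add0n !addn_eq0 !eqb0.
move: (hits J (leaf0 b) == 0)%N (hits J (leaf1 b) == 0)%N (hits J (leaf2 b) == 0)%N => h0 h1 h2.
move: (hits J (leaf3 b) == 0)%N (hits J (leaf4 b) == 0)%N (hits J (leaf5 b) == 0)%N => h3 h4 h5.
repeat match goal with |- context [edge ?x ?y] => move: (edge x y) => ? end.
(* A selected blocked leaf makes both sides false. Hence every selected leaf may be taken to be
   free, and then no edge between selected leaves has been dropped. *)
(case: t0; first (case: h0; rewrite /= ?andbF //));
(case: t1; first (case: h1; rewrite /= ?andbF //));
(case: t2; first (case: h2; rewrite /= ?andbF //));
(case: t3; first (case: h3; rewrite /= ?andbF //));
(case: t4; first (case: h4; rewrite /= ?andbF //));
(case: t5; first (case: h5; rewrite /= ?andbF //));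
rewrite /= ?andbF ?andbT //=;
repeat match goal with |- context [~~ ?e] =>
  is_var e; destruct e; rewrite /= ?andbF ?andbT //= end.
Qed.

(** The second conditioning splits off the occupied leaves. The remaining set [J] matters only
    through the leaves it blocks, which leaves finitely many polynomials. *)
Lemma vertex_sum_view :
  vertex_sum lambda v =
  \sum_(J : {set G} | (J \subset ~: [set x in ball_seq b]) && (J \in independent G))
    lambda ^+ #|J| * evalp lambda (view_sum (free_leaves J) (free_edges J)).
Proof.
have := ball_uniq b; rewrite -[_ :: _]/([:: v; mid0 b; mid1 b; mid2 b] ++ leaves b).
rewrite cat_uniq => /and3P[core_uniq disj leaves_uniq].
rewrite (vertex_sum_core lambda no_triangle core_uniq (nbrs_root b)).
rewrite big_mkcondr (sum_subsets_split _ leaves_uniq); last first.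
  by move=> x xl; rewrite in_setC in_set; apply: contra disj => xc; apply/hasP; exists x.
have -> : ~: [set x in [:: v; mid0 b; mid1 b; mid2 b]] :\: [set x in leaves b] =
    ~: [set x in ball_seq b].
  apply/setP => x; rewrite in_setD !in_setC !in_set /ball_seq mem_cat negb_or.
  by rewrite andbC.
rewrite [RHS]big_mkcondr; apply: eq_bigr => J sJ.
have dis : [disjoint J & ball_seq b].
  rewrite disjoint_subset; apply/subsetP => x xJ; have := subsetP sJ _ xJ.
  by rewrite in_setC in_set.
have disS s : {subset s <= ball_seq b} -> [disjoint J & s].
  by move=> ss; apply: disjointWr dis; apply/subsetP.
have dis_leaves : [disjoint J & leaves b].
  by apply: disS => x xl; rewrite mem_cat xl orbT.
case: ifP => indJ; last first.
  rewrite big1_seq // => m _; rewrite ifF //; apply: contraFF indJ.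
  by apply: independentS; rewrite subsetUl.
rewrite /view_sum evalp_sum big_map big_filter mulr_sumr [RHS]big_mkcond.
have -> : size (leaves b) = 6 by [].
rewrite big_seq [RHS]big_seq; apply: eq_bigr => t /mem_masks t_size.
rewrite independent_with_selected // indJ selectable_leaves //=.
case: ifP => // _; rewrite evalp_shift mulrA -exprD.
have -> : #|with_selected J (leaves b) t| = (#|J| + count id t)%N.
  rewrite -[with_selected _ _ _]setTI card_with_selected // setTI; congr (_ + _)%N.
  rewrite (eq_count (a2 := predT)) => [|x]; last by rewrite /= inE.
  by rewrite count_predT size_mask.
congr (_ * evalp _ _).
(* All neighbours of a neighbour of [v] lie in the ball, so [J] contains none of them. *)
have /and3P[/eqP hits0 /eqP hits1 /eqP hits2] :
    [&& hits J (mid0 b) == 0, hits J (mid1 b) == 0 & hits J (mid2 b) == 0]%N.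
  by apply/and3P; split; apply/eqP;
    [apply: (hits_nbrs (nbrs_mid0 b)) | apply: (hits_nbrs (nbrs_mid1 b)) |
     apply: (hits_nbrs (nbrs_mid2 b))]; apply: disS => x; rewrite !inE => /or3P[] /eqP->;
    rewrite ?inE eqxx ?orbT.
rewrite !hits_selected // hits0 hits1 hits2 !add0n.
case: t t_size => [//|t0 [//|t1 [//|t2 [//|t3 [//|t4 [//|t5 [|//]]]]]]] _.
rewrite /leaves !count_mask_cons; cbn [nth]; cbn [mask count]; rewrite !addn0.
have [m0 [m1 m2]] := mid_edges.
move: m0 m1 m2; rewrite /= => -[-> -> -> -> -> ->] [-> -> -> -> -> ->] [-> -> -> -> -> ->].
rewrite !andbF !andbT !addn0 !add0n core_lookupE //.
- by case: (t0) (t1) => [] [].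
- by case: (t2) (t3) => [] [].
- by case: (t4) (t5) => [] [].
Qed.
End View.

(** * Sign of the vertex sums, from the finite check *)

Section ViewBounds.
Variable G : sgraph.
Hypothesis no_triangle : forall x y z : G, edge x y -> edge x z -> ~~ edge y z.
Hypothesis no_square : forall x y a b : G, x != y ->
  edge x a -> edge x b -> edge y a -> edge y b -> a = b.

(** Two edges with a common endpoint would form a 4-cycle with [m] or [m']. The bits [c0] to [c3]
    account for the edges dropped at blocked leaves. *)
Lemma matching_cross (m m' p q r s : G) (c0 c1 c2 c3 : bool) :
  uniq [:: m; p; q; m'; r; s] ->
  edge m p -> edge m q -> edge m' r -> edge m' s ->
  matching [:: edge p r && c0; edge p s && c1; edge q r && c2; edge q s && c3].
Proof.
move=> U mp mq mr ms.
have {}U : [&& p != m', q != m', r != m, s != m, p != q & r != s].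
  move: U; rewrite /= !inE !negb_or -!andbA.
  case/and5P=> _ _ _ mr' /and5P[ms' pq pm _ /and5P[_ qm _ _ /and3P[_ _ /andP[rs _]]]].
  by rewrite pm qm (eq_sym r) (eq_sym s) mr' ms' pq rs.
case/and5P: U => pm qm rm sm /andP[pq rs].
rewrite /matching /=; apply/and4P; split; apply/negP => /andP[/andP[e1 _] /andP[e2 _]].
- by case/eqP: rs; apply: (no_square pm).
- by case/eqP: rs; apply: (no_square qm).
- by case/eqP: pq; apply: (no_square rm); rewrite // edge_sym.
- by case/eqP: pq; apply: (no_square sm); rewrite // edge_sym.
Qed.

Lemma view_checked (v : G) (b : ball v) (J : {set G}) :
  view_check (free_leaves b J) (free_edges b J).
Proof.
have mp0 : edge (mid0 b) (leaf0 b) by rewrite edge_nbrs nbrs_mid0 !inE eqxx ?orbT.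
have mp1 : edge (mid0 b) (leaf1 b) by rewrite edge_nbrs nbrs_mid0 !inE eqxx ?orbT.
have mp2 : edge (mid1 b) (leaf2 b) by rewrite edge_nbrs nbrs_mid1 !inE eqxx ?orbT.
have mp3 : edge (mid1 b) (leaf3 b) by rewrite edge_nbrs nbrs_mid1 !inE eqxx ?orbT.
have mp4 : edge (mid2 b) (leaf4 b) by rewrite edge_nbrs nbrs_mid2 !inE eqxx ?orbT.
have mp5 : edge (mid2 b) (leaf5 b) by rewrite edge_nbrs nbrs_mid2 !inE eqxx ?orbT.
have U01 : uniq [:: mid0 b; leaf0 b; leaf1 b; mid1 b; leaf2 b; leaf3 b].
  by ball_distinct b.
have U02 : uniq [:: mid0 b; leaf0 b; leaf1 b; mid2 b; leaf4 b; leaf5 b].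
  by ball_distinct b.
have U12 : uniq [:: mid1 b; leaf2 b; leaf3 b; mid2 b; leaf4 b; leaf5 b].
  by ball_distinct b.
have := all_views_ok; rewrite /all_views_check => /allP /(_ (free_leaves b J)).
rewrite masks_mem => /(_ isT).
set u := free_leaves b J.
have inL ps : size ps = 4%N ->
    matching [seq [&& edge (nth v (leaves b) p.1) (nth v (leaves b) p.2),
                     nth false u p.1 & nth false u p.2] | p <- ps] ->
    [seq [&& edge (nth v (leaves b) p.1) (nth v (leaves b) p.2),
                     nth false u p.1 & nth false u p.2] | p <- ps] \in
    local_edges u ps.
  move=> sz mt; rewrite mem_filter mt /=.
  move: (masks_mem [seq [&& edge (nth v (leaves b) p.1) (nth v (leaves b) p.2),
                     nth false u p.1 & nth false u p.2] | p <- ps]).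
  rewrite size_map sz => ->; rewrite andbT /edges_within.
  by elim: ps {sz mt} => //= p ps ->; rewrite andbT; apply/implyP => /andP[].
have M01 := matching_cross _ _ _ _ U01 mp0 mp1 mp2 mp3.
have M02 := matching_cross _ _ _ _ U02 mp0 mp1 mp4 mp5.
have M12 := matching_cross _ _ _ _ U12 mp2 mp3 mp4 mp5.
move=> /allP /(_ _ (inL cross_pairs01 erefl (M01 _ _ _ _))).
move=> /allP /(_ _ (inL cross_pairs02 erefl (M02 _ _ _ _))).
by move=> /allP /(_ _ (inL cross_pairs12 erefl (M12 _ _ _ _))).
Qed.

Variables (R : realFieldType) (lambda : R).
Hypothesis lambda_gt0 : 0 < lambda.

Lemma view_sum_le0 (v : G) (b : ball v) J :
  evalp lambda (view_sum (free_leaves b J) (free_edges b J)) <= 0.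
Proof.
have /and3P[q_ge0 _ _] := view_checked b J.
by rewrite -oppr_ge0 -evalp_opp evalp_ge0.
Qed.

Lemma strict_view_sum (v : G) (b : ball v) J :
  strict_view (free_leaves b J) (free_edges b J) ->
  evalp lambda (view_sum (free_leaves b J) (free_edges b J)) < 0.
Proof.
have /and3P[q_ge0 /implyP q_gt0 _] := view_checked b J => /q_gt0 {}q_gt0.
by rewrite -oppr_gt0 -evalp_opp evalp_gt0.
Qed.

Lemma tight_view_sum (v : G) (b : ball v) J :
  tight_view (free_leaves b J) (free_edges b J) ->
  evalp lambda (view_sum (free_leaves b J) (free_edges b J)) = 0.
Proof.
have /and3P[_ _ /implyP q_eq0] := view_checked b J => /q_eq0 {}q_eq0.
by rewrite -[LHS]opprK -evalp_opp evalp_null ?oppr0.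
Qed.

Lemma vertex_sum_le0 (v : G) : ball v -> vertex_sum lambda v <= 0.
Proof.
move=> b; rewrite (vertex_sum_view b lambda no_triangle) sumr_le0 // => J _.
by rewrite mulr_ge0_le0 ?view_sum_le0 // exprn_ge0 ?ltW.
Qed.

(** All terms of the sum are nonpositive, so each vanishes, and the weight of [J] is positive; a
    strict view would make its term negative. *)
Lemma vertex_sum_eq0_not_strict (v : G) (b : ball v) (J : {set G}) :
  vertex_sum lambda v = 0 -> [disjoint J & ball_seq b] -> J \in independent G ->
  ~~ strict_view (free_leaves b J) (free_edges b J).
Proof.
rewrite (vertex_sum_view b lambda no_triangle) => sum0 dis indJ.
have sJ : J \subset ~: [set x in ball_seq b].
  apply/subsetP => x xJ; rewrite in_setC in_set.
  by rewrite (disjointFr dis xJ).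
apply/negP => /strict_view_sum view_lt0.
have term_ge0 (K : {set G}) : (K \subset ~: [set x in ball_seq b]) && (K \in independent G) ->
    0 <= - (lambda ^+ #|K| * evalp lambda (view_sum (free_leaves b K) (free_edges b K))).
  by rewrite oppr_ge0 mulr_ge0_le0 ?view_sum_le0 // exprn_ge0 ?ltW.
have := psumr_eq0P term_ge0; rewrite sumrN sum0 oppr0 => /(_ erefl J).
rewrite sJ indJ => /(_ isT) /eqP; rewrite oppr_eq0 mulf_eq0 expf_eq0.
by rewrite (gt_eqF lambda_gt0) (lt_eqF view_lt0) andbF.
Qed.

Hypothesis G_cubic : cubic G.

Lemma cubic_nbrs (x : G) : exists a b c, uniq [:: a; b; c] /\ nbrs x =i [:: a; b; c].
Proof.
have := G_cubic x; rewrite -/(nbrs x) cardE => sz.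
have U := enum_uniq (nbrs x).
have E y : (y \in nbrs x) = (y \in enum (nbrs x)) by rewrite mem_enum.
move: sz U E; case: (enum _) => [|a [|b' [|c [|]]]] // _ U E.
by exists a, b', c.
Qed.

Lemma cubic_nbrs1 (x a : G) : edge x a ->
  exists b c, uniq [:: a; b; c] /\ nbrs x =i [:: a; b; c].
Proof.
have [p [q [r [U E]]]] := cubic_nbrs x => xa.
have : a \in nbrs x by rewrite inE.
rewrite E !inE => /or3P[] /eqP->.
- by exists q, r.
- exists p, r; split; first by rewrite (uniq_catCA [:: q] [:: p] [:: r]).
  by move=> y; rewrite E !inE orbCA.
- exists p, q; split; first by rewrite (uniq_catC [:: r] [:: p; q]).
  by move=> y; rewrite E !inE orbA orbC.
Qed.

(** Any coincidence among the ten vertices would produce a loop, a triangle ([not_mid]) or a 4-cycle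
    through [v] ([leaf_neq]). *)
Lemma ball_exists (v : G) : inhabited (ball v).
Proof.
have [u0 [u1 [u2 [Uu Nv]]]] := cubic_nbrs v.
have vu0 : edge v u0 by rewrite edge_nbrs Nv !inE eqxx.
have vu1 : edge v u1 by rewrite edge_nbrs Nv !inE eqxx ?orbT.
have vu2 : edge v u2 by rewrite edge_nbrs Nv !inE eqxx ?orbT.
have [w0 [w1 [U0 N0]]] := @cubic_nbrs1 u0 v (etrans (edge_sym _ _) vu0).
have [w2 [w3 [U1 N1]]] := @cubic_nbrs1 u1 v (etrans (edge_sym _ _) vu1).
have [w4 [w5 [U2 N2]]] := @cubic_nbrs1 u2 v (etrans (edge_sym _ _) vu2).
have edge_mem0 w : w \in [:: v; w0; w1] -> edge u0 w by rewrite edge_nbrs N0.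
have edge_mem1 w : w \in [:: v; w2; w3] -> edge u1 w by rewrite edge_nbrs N1.
have edge_mem2 w : w \in [:: v; w4; w5] -> edge u2 w by rewrite edge_nbrs N2.
have not_mid (u u' w : G) : edge v u -> edge v u' -> edge u w -> u' != w.
  move=> vu vu' uw; apply: contraTneq uw => <-; exact: no_triangle vu vu'.
have leaf_neq (u u' w w' : G) : u != u' -> edge v u -> edge v u' ->
    edge u w -> edge u' w' -> v != w -> w != w'.
  move=> uu' vu vu' uw uw' vw; apply: contraNneq vw => E; rewrite -E in uw'.
  by apply/eqP; apply: (no_square uu') => //; rewrite edge_sym.
have e00 : edge u0 w0 by apply: edge_mem0; rewrite !inE eqxx ?orbT.
have e01 : edge u0 w1 by apply: edge_mem0; rewrite !inE eqxx ?orbT.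
have e12 : edge u1 w2 by apply: edge_mem1; rewrite !inE eqxx ?orbT.
have e13 : edge u1 w3 by apply: edge_mem1; rewrite !inE eqxx ?orbT.
have e24 : edge u2 w4 by apply: edge_mem2; rewrite !inE eqxx ?orbT.
have e25 : edge u2 w5 by apply: edge_mem2; rewrite !inE eqxx ?orbT.
move: Uu U0 U1 U2; rewrite /= !inE !negb_or !andbT.
case/andP=> /andP[u01 u02] u12 /andP[/andP[vw0 vw1] w01].
case/andP=> /andP[vw2 vw3] w23 /andP[/andP[vw4 vw5] w45].
constructor; apply: Ball Nv N0 N1 N2.
rewrite /= !inE !negb_or !andbT; repeat (apply/andP; split);
  eauto using edge_neq, not_mid, leaf_neq.
Qed.

End ViewBounds.

(** * From vertex sums to the occupancy fraction *)

Section Occupancy.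
Variables (R : realType) (G : sgraph) (lambda : R).
Hypothesis lambda_gt0 : 0 < lambda.
Hypothesis G_cubic : cubic G.

Let Z : R := (indep_poly R G).[lambda].

Lemma indep_polyE : Z = \sum_(I in independent G) lambda ^+ #|I|.
Proof.
by rewrite /Z /indep_poly horner_sum; apply: eq_bigr => I _; rewrite hornerXn.
Qed.

Lemma indep_poly_gt0 : 0 < Z.
Proof.
rewrite indep_polyE (bigD1 set0) /=; last first.
  by apply/independentP => x y; rewrite inE.
rewrite cards0 expr0 ltr_wpDr // sumr_ge0 // => I _.
by rewrite exprn_ge0 ?ltW.
Qed.

Lemma sum_nbrs (f : G -> R) : \sum_v \sum_(u in nbrs v) f u = \sum_u f u *+ 3.
Proof.
rewrite (exchange_big_dep predT) //=; apply: eq_bigr => u _.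
rewrite sumr_const; congr (_ *+ _); rewrite -(G_cubic u); apply: eq_card => v.
by rewrite -[LHS]/(u \in nbrs v) !inE edge_sym.
Qed.

(** Each vertex has three neighbours, so every M(n(u)) is subtracted three times and cancels the
    term 3 M(n(u)) in its own score. *)
Lemma sum_score (I : {set G}) :
  \sum_v score lambda I v =
  (evalp lambda unitp * #|I|%:R - evalp lambda valuep * #|G|%:R) *+ 3.
Proof.
rewrite /score !sumrB big_split /= sum_nbrs addrK sumr_const mulrnBl.
rewrite !mulr_natr; congr (_ - _); last by rewrite mulrnAC.
rewrite mulrnAC -sumr_const [RHS]big_mkcond /=.
by apply: eq_bigr => v _; case: (v \in I).
Qed.

Lemma sum_vertex_sum : (0 < #|G|)%N ->
  \sum_(v : G) vertex_sum lambda v =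
  (evalp lambda unitp * occupancy G lambda - evalp lambda valuep) *
    (#|G|%:R * Z) *+ 3.
Proof.
move=> G_gt0; rewrite /vertex_sum exchange_big /=.
have G_neq0 : #|G|%:R != 0 :> R by rewrite pnatr_eq0 -lt0n.
have occE : occupancy G lambda * (#|G|%:R * Z) =
    \sum_(I in independent G) lambda ^+ #|I| * #|I|%:R.
  rewrite /occupancy mulrA divfK // mulr_suml [RHS]big_mkcond /=.
  apply: eq_bigr => I _; rewrite /hardcore -/Z; case: ifP => _; last by rewrite !mul0r.
  by rewrite mulrAC divfK // gt_eqF ?indep_poly_gt0.
rewrite mulrBl -mulrA occE mulr_sumr indep_polyE !mulr_sumr -sumrB -sumrMnl.
by apply: eq_bigr => I _; rewrite -mulr_sumr sum_score; ring.
Qed.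

End Occupancy.

(** * The Heawood graph *)

Section HeawoodGraph.

Definition point (i : nat) : heawood := inl (inZp i).
Definition line (i : nat) : heawood := inr (inZp i).

(** Adjacency depends only on the difference p - l, which makes the automorphisms visible. *)
Lemma heawood_edge_point_line (p l : 'Z_7) :
  @edge heawood (inl p) (inr l) = (p - l \in [:: 0; 1; 3]).
Proof. by rewrite /= /fano_line !inE !subr_eq add0r ![_ + l]addrC orbA. Qed.

Lemma heawood_edge_line_point (p l : 'Z_7) :
  @edge heawood (inr l) (inl p) = (p - l \in [:: 0; 1; 3]).
Proof. by rewrite edge_sym heawood_edge_point_line. Qed.

Definition heawood_nbrs (a : heawood) : seq heawood :=
  match a with
  | inl p => [:: inr p; inr (p - 1); inr (p - 3)]
  | inr l => [:: inl l; inl (l + 1); inl (l + 3)]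
  end.

Lemma heawood_edgeE (a b : heawood) : edge a b = (b \in heawood_nbrs a).
Proof.
case: a b => a [] b; rewrite ?heawood_edge_point_line ?heawood_edge_line_point //.
all: case: a => -[|[|[|[|[|[|[|//]]]]]]] ?; case: b => -[|[|[|[|[|[|[|//]]]]]]] ?.
all: by vm_compute.
Qed.

Lemma heawood_nbrs_uniq (a : heawood) : uniq (heawood_nbrs a).
Proof.
by case: a => -[[|[|[|[|[|[|[|//]]]]]]] ?].
Qed.

(** Translations reach every point. Exchanging points and lines by x |-> a - x preserves the
    difference p - l and reaches every line. *)
Lemma heawood_transitive (h : heawood) :
  exists t : heawood -> heawood,
    [/\ injective t, forall a b, edge (t a) (t b) = edge a b & t (point 0) = h].
Proof.
case: h => a.
  exists (fun x => match x with inl p => inl (p + a) | inr l => inr (l + a) end).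
  split.
  - apply: (can_inj (g := fun x => match x with inl p => inl (p - a) | inr l => inr (l - a) end)).
    by case=> x; rewrite addrK.
  - case=> x [] y //; rewrite ?heawood_edge_point_line ?heawood_edge_line_point //.
      by rewrite opprD addrACA subrr addr0.
    by rewrite opprD addrACA subrr addr0.
  - by rewrite /point; congr inl; rewrite -[RHS]add0r; congr (_ + _); apply: val_inj.
exists (fun x => match x with inl p => inr (a - p) | inr l => inl (a - l) end).
split.
- by apply: inv_inj => -[] x; rewrite subKr.
- case=> x [] y //; rewrite ?heawood_edge_point_line ?heawood_edge_line_point //.
    by rewrite opprB addrC addrA subrK.
  by rewrite opprB addrC addrA subrK.
- by rewrite /point; congr inr; rewrite -[RHS]subr0; congr (_ - _); apply: val_inj.
Qed.

End HeawoodGraph.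

(** * Embedded copies of the Heawood graph and components *)

Section Embedding.
Variable G : sgraph.
Hypothesis no_triangle : forall x y z : G, edge x y -> edge x z -> ~~ edge y z.
Hypothesis no_square : forall x y a b : G, x != y ->
  edge x a -> edge x b -> edge y a -> edge y b -> a = b.
Hypothesis G_cubic : cubic G.

(** A rooted induced copy at [v]. For cubic graphs this amounts to the component of [v] being the
    Heawood graph, but needs no subtype of vertices. *)
Definition heawood_at (v : G) : Prop :=
  exists f : heawood -> G,
    [/\ injective f, forall a b, edge (f a) (f b) = edge a b & f (point 0) = v].

Lemma cubic_nbrs3 (x a b c : G) : uniq [:: a; b; c] ->
  edge x a -> edge x b -> edge x c -> nbrs x =i [:: a; b; c].
Proof.
move=> U xa xb xc y; have := G_cubic x; rewrite -/(nbrs x) => card_x.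
have /subset_cardP E : #|[:: a; b; c]| = #|nbrs x|.
  by rewrite card_x; apply/card_uniqP.
suff /E -> : [:: a; b; c] \subset nbrs x by [].
by apply/subsetP => z; rewrite !inE => /or3P[] /eqP->.
Qed.

Lemma embedding_nbrs (f : heawood -> G) (a : heawood) (t : seq heawood) :
  injective f -> (forall b, b \in heawood_nbrs a -> edge (f a) (f b)) ->
  perm_eq t (heawood_nbrs a) -> nbrs (f a) =i map f t.
Proof.
move=> f_inj f_edge /perm_mem t_a y.
have -> : (y \in map f t) = (y \in map f (heawood_nbrs a)) by apply: eq_mem_map.
have U : uniq (map f (heawood_nbrs a)) by rewrite map_inj_uniq ?heawood_nbrs_uniq.
have mem_nbr b : b \in map f (heawood_nbrs a) -> edge (f a) b.
  by case/mapP=> c /f_edge ac ->.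
by case: a U mem_nbr {f_edge t_a} => a U mem_nbr; apply: cubic_nbrs3 => //;
  apply: mem_nbr; rewrite !inE eqxx ?orbT.
Qed.

(** The three images of the neighbours of a vertex already exhaust the neighbourhood of its image,
    so no further edges can occur. *)
Lemma hom_embedding (f : heawood -> G) :
  injective f ->
  (forall p l : 'Z_7, inr l \in heawood_nbrs (inl p) -> edge (f (inl p)) (f (inr l))) ->
  forall a b, edge (f a) (f b) = edge a b.
Proof.
move=> f_inj f_edge a b.
have hom c d : d \in heawood_nbrs c -> edge (f c) (f d).
  case: c d => c [] d; [by rewrite -heawood_edgeE | exact: f_edge | | by rewrite -heawood_edgeE].
  by rewrite -heawood_edgeE edge_sym heawood_edgeE => /f_edge; rewrite edge_sym.
have := embedding_nbrs f_inj (hom a) (perm_refl _) (f b).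
by rewrite inE mem_map // -heawood_edgeE.
Qed.

Lemma hits_eq0_seq (J : {set G}) (x : G) (s : seq G) :
  nbrs x =i s -> (hits J x == 0)%N = all (fun y => y \notin J) s.
Proof.
move=> Nx; apply/hits_eq0P/allP => [H y|H y yJ].
  by rewrite -Nx inE => xy; apply/negP => /H; rewrite xy.
by apply/negP => xy; have := H y; rewrite -Nx inE xy yJ => /(_ isT).
Qed.

Lemma heawood_vertex_sum (R : realFieldType) (lambda : R) (v : G) :
  0 < lambda -> heawood_at v -> vertex_sum lambda v = 0.
Proof.
move=> lambda_gt0 [f [f_inj f_edge <-]].
have nbrsE a t : perm_eq t (heawood_nbrs a) -> nbrs (f a) =i map f t.
  by apply: embedding_nbrs => // b; rewrite f_edge heawood_edgeE.
have mem_ball : uniq (map f [:: point 0; line 0; line 6; line 4;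
    point 1; point 3; point 2; point 6; point 4; point 5]).
  by rewrite map_inj_uniq.
pose b : ball (f (point 0)) := Ball mem_ball
  (nbrsE (point 0) [:: line 0; line 6; line 4] isT)
  (nbrsE (line 0) [:: point 0; point 1; point 3] isT)
  (nbrsE (line 6) [:: point 0; point 2; point 6] isT)
  (nbrsE (line 4) [:: point 0; point 4; point 5] isT).
rewrite (vertex_sum_view b lambda no_triangle) big1 // => J /andP[sJ _].
rewrite (tight_view_sum no_square) ?mulr0 //.
have notJ x : x \in ball_seq b -> x \notin J.
  by apply: contraL => /(subsetP sJ); rewrite in_setC in_set.
have free_edges0 : free_edges b J = nseq 12 false.
  by rewrite /free_edges /= !f_edge.
have free i t : perm_eq t (heawood_nbrs (point i)) ->
    (hits J (f (point i)) == 0)%N = all (fun y => f y \notin J) t.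
  by move=> /nbrsE/(hits_eq0_seq J) ->; rewrite all_map.
have J0 : f (line 0) \notin J by apply: notJ; rewrite !inE eqxx ?orbT.
have J6 : f (line 6) \notin J by apply: notJ; rewrite !inE eqxx ?orbT.
have J4 : f (line 4) \notin J by apply: notJ; rewrite !inE eqxx ?orbT.
rewrite free_edges0 /free_leaves /=.
rewrite (free 1%N [:: line 0; line 1; line 5]) // (free 3%N [:: line 0; line 2; line 3]) //.
rewrite (free 2%N [:: line 6; line 1; line 2]) // (free 6%N [:: line 6; line 3; line 5]) //.
rewrite (free 4%N [:: line 4; line 1; line 3]) // (free 5%N [:: line 4; line 2; line 5]) //.
rewrite /= J0 J4 J6 /= !andbT.
by case: (f (line 1) \in J) (f (line 2) \in J) (f (line 3) \in J) (f (line 5) \in J) => [] [] [] [].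
Qed.

(** The image of the embedding is connected, and closed under adjacency because [G] is cubic; hence
    it is the whole component. *)
Lemma heawood_at_component (v : G) :
  heawood_at v -> isomorphic (component v) heawood.
Proof.
move=> [f [f_inj f_edge fv]].
have step a b : edge a b -> connect (@edge G) v (f a) -> connect (@edge G) v (f b).
  by move=> ab /connect_trans -> //; apply: connect1; rewrite f_edge.
have con0 : connect (@edge G) v (f (point 0)) by rewrite fv.
have conl l : line l \in heawood_nbrs (point 0) -> connect (@edge G) v (f (line l)).
  by rewrite -heawood_edgeE => /step; apply.
have conp (p : 'Z_7) : connect (@edge G) v (f (inl p)).
  (* Every point lies on a line through the point 0. *)
  have [l l0 pl] : exists2 l, line l \in heawood_nbrs (point 0) &
                      inl p \in heawood_nbrs (line l).
    case: p => -[|[|[|[|[|[|[|//]]]]]]] p_lt.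
    - by exists 0%N.
    - by exists 0%N.
    - by exists 6%N.
    - by exists 0%N.
    - by exists 4%N.
    - by exists 4%N.
    - by exists 6%N.
  by apply: (step (line l)); rewrite ?heawood_edgeE ?conl.
have con a : connect (@edge G) v (f a).
  case: a => [//|l]; apply: (step (inl l)) => //.
  by rewrite heawood_edgeE !inE eqxx.
have image_closed y : connect (@edge G) v y -> y \in codom f.
  have cl : closed (@edge G) (mem (codom f)).
    apply: intro_closed => [|x z xz /codomP[a x_fa]].
      exact/sym_connect_sym/edge_sym.
    have : z \in nbrs (f a) by rewrite inE -x_fa.
    rewrite (embedding_nbrs f_inj _ (perm_refl _)) => [/mapP[c _ ->]|c].
      exact: codom_f.
    by rewrite f_edge heawood_edgeE.
  by move=> /(closed_connect cl) <-; rewrite -fv; apply: codom_f.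
have in_comp (y : component v) : connect (@edge G) v (val y).
  by have := valP y; rewrite inE.
pose g (y : component v) : heawood := iinv (image_closed _ (in_comp y)).
have fg y : f (g y) = val y by apply: f_iinv.
exists g; last by move=> x y; rewrite -f_edge !fg.
have f_comp a : f a \in [set y | connect (@edge G) v y] by rewrite inE.
exists (fun a => Sub (f a) (f_comp a)) => [y|a]; last by apply: f_inj; rewrite fg.
by apply: val_inj; rewrite /= fg.
Qed.

Lemma component_heawood_at (v : G) :
  isomorphic (component v) heawood -> heawood_at v.
Proof.
move=> [g [g' gK g'K] g_edge].
have v_comp : v \in [set y | connect (@edge G) v y] by rewrite inE connect0.
have [t [t_inj t_edge tE]] := heawood_transitive (g (Sub v v_comp)).
exists (fun a => val (g' (t a))); split.
- by move=> a b /val_inj /(can_inj g'K) /t_inj.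
- move=> a b; rewrite -t_edge -{2}[t a]g'K -{2}[t b]g'K g_edge.
  by [].
- by rewrite tE gK.
Qed.

End Embedding.

(** * Reconstruction of the Heawood graph from a vanishing vertex sum *)

Lemma swap_leaves23 (G : sgraph) (v : G) (b : ball v) :
  exists2 b' : ball v, leaves b' =
    [:: leaf0 b; leaf1 b; leaf3 b; leaf2 b; leaf4 b; leaf5 b] & mid0 b' = mid0 b.
Proof.
have U : uniq [:: v; mid0 b; mid1 b; mid2 b; leaf0 b; leaf1 b; leaf3 b; leaf2 b;
                  leaf4 b; leaf5 b].
  by ball_distinct b.
have N1 : nbrs (mid1 b) =i [:: v; leaf3 b; leaf2 b].
  by move=> x; rewrite nbrs_mid1 !inE [(x == leaf2 b) || _]orbC.
by exists (Ball U (nbrs_root b) (nbrs_mid0 b) N1 (nbrs_mid2 b)).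
Qed.

Lemma swap_leaves45 (G : sgraph) (v : G) (b : ball v) :
  exists2 b' : ball v, leaves b' =
    [:: leaf0 b; leaf1 b; leaf2 b; leaf3 b; leaf5 b; leaf4 b] & mid0 b' = mid0 b.
Proof.
have U : uniq [:: v; mid0 b; mid1 b; mid2 b; leaf0 b; leaf1 b; leaf2 b; leaf3 b;
                  leaf5 b; leaf4 b].
  by ball_distinct b.
have N2 : nbrs (mid2 b) =i [:: v; leaf5 b; leaf4 b].
  by move=> x; rewrite nbrs_mid2 !inE [(x == leaf4 b) || _]orbC.
by exists (Ball U (nbrs_root b) (nbrs_mid0 b) (nbrs_mid1 b) N2).
Qed.

Section Reconstruction.
Variables (G : sgraph) (R : realFieldType) (lambda : R) (v : G).
Hypothesis no_triangle : forall x y z : G, edge x y -> edge x z -> ~~ edge y z.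
Hypothesis no_square : forall x y a b : G, x != y ->
  edge x a -> edge x b -> edge y a -> edge y b -> a = b.
Hypothesis G_cubic : cubic G.
Hypothesis lambda_gt0 : 0 < lambda.
Hypothesis sum_eq0 : vertex_sum lambda v = 0.

Lemma hits_set1 (x w : G) : (hits [set x] w == 0)%N = ~~ edge w x.
Proof.
by apply/hits_eq0P/idP => [->|wx y]; rewrite ?inE // => /eqP->.
Qed.

(** Take [J] empty: all leaves are free, and an edge between them would make the view strict. *)
Lemma tight_no_leaf_edges (b : ball v) :
  {in leaves b &, forall w w', ~~ edge w w'}.
Proof.
have := vertex_sum_eq0_not_strict no_triangle no_square lambda_gt0 (b := b) (J := set0) sum_eq0.
have free0 : free_leaves b set0 = nseq 6 true.
  by rewrite /free_leaves /= /hits !setI0 cards0.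
have -> : [disjoint set0 & ball_seq b].
  by rewrite disjoint_subset; apply/subsetP => y; rewrite inE.
rewrite /free_edges free0 => /(_ isT).
have -> : set0 \in independent G by apply/independentP => x y; rewrite inE.
move=> /(_ isT); rewrite /strict_view /= !andbT !orbF !negb_or.
repeat (case/andP=> /negbTE ?); move=> /negbTE ?.
have ? : edge (leaf0 b) (leaf1 b) = false.
  by apply/negbTE/(@no_triangle (mid0 b)); rewrite edge_nbrs nbrs_mid0 !inE eqxx ?orbT.
have ? : edge (leaf2 b) (leaf3 b) = false.
  by apply/negbTE/(@no_triangle (mid1 b)); rewrite edge_nbrs nbrs_mid1 !inE eqxx ?orbT.
have ? : edge (leaf4 b) (leaf5 b) = false.
  by apply/negbTE/(@no_triangle (mid2 b)); rewrite edge_nbrs nbrs_mid2 !inE eqxx ?orbT.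
move=> w w'; rewrite !inE.
do 5?[case/orP]; move=> /eqP->; do 5?[case/orP]; move=> /eqP->;
  first [by rewrite edge_irrefl | apply/negbT; assumption
        | rewrite edge_sym; apply/negbT; assumption].
Qed.

(** Take [J] = {x}. Without 4-cycles [x] sees at most one leaf of each pair; if it missed a pair
    entirely, the view would be strict. *)
Lemma tight_transversal (b : ball v) (x : G) :
  x \notin ball_seq b -> has (edge x) (leaves b) ->
  [&& edge x (leaf0 b) (+) edge x (leaf1 b), edge x (leaf2 b) (+) edge x (leaf3 b)
    & edge x (leaf4 b) (+) edge x (leaf5 b)].
Proof.
move=> x_ball x_leaf.
have := vertex_sum_eq0_not_strict no_triangle no_square lambda_gt0 (b := b) (J := [set x]) sum_eq0.
have -> : [disjoint [set x] & ball_seq b].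
  by rewrite disjoint_subset; apply/subsetP => y; rewrite inE => /eqP->.
have -> : [set x] \in independent G.
  by apply/independentP => y z; rewrite !inE => /eqP-> /eqP->; rewrite edge_irrefl.
move=> /(_ isT isT).
have -> : free_edges b [set x] = nseq 12 false.
  have no_edge i j : (i < 6)%N -> (j < 6)%N ->
      edge (nth v (leaves b) i) (nth v (leaves b) j) = false.
    by move=> i6 j6; apply/negbTE/(@tight_no_leaf_edges b); apply: mem_nth.
  rewrite -[RHS]/(map (fun _ => false) cross_pairs); apply/eq_in_map => p.
  have small : {in cross_pairs, forall q, (q.1 < 6) && (q.2 < 6)}%N by apply/allP.
  by move=> /small /andP[i6 j6]; rewrite no_edge.
have -> : free_leaves b [set x] = [seq ~~ edge x w | w <- leaves b].
  by apply: eq_map => w; rewrite hits_set1 edge_sym.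
have not_both (m w w' : G) : m \in ball_seq b -> edge m w -> edge m w' -> w != w' ->
    ~~ (edge x w && edge x w').
  move=> mb mw mw' ww'; apply: contra ww' => /andP[xw xw']; apply/eqP.
  by apply: (no_square _ xw xw' mw mw'); apply: contraNneq x_ball => ->.
have N01 : ~~ (edge x (leaf0 b) && edge x (leaf1 b)).
  apply: (not_both (mid0 b)); rewrite ?edge_nbrs ?nbrs_mid0 ?inE ?eqxx ?orbT //.
  by ball_distinct b.
have N23 : ~~ (edge x (leaf2 b) && edge x (leaf3 b)).
  apply: (not_both (mid1 b)); rewrite ?edge_nbrs ?nbrs_mid1 ?inE ?eqxx ?orbT //.
  by ball_distinct b.
have N45 : ~~ (edge x (leaf4 b) && edge x (leaf5 b)).
  apply: (not_both (mid2 b)); rewrite ?edge_nbrs ?nbrs_mid2 ?inE ?eqxx ?orbT //.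
  by ball_distinct b.
move: x_leaf N01 N23 N45; rewrite /=.
by do 6?[case: (edge x _)].
Qed.

Lemma leaf_nbr_notin (b : ball v) (w x : G) :
  w \in leaves b -> edge w x -> x \notin [:: mid0 b; mid1 b; mid2 b] ->
  x \notin ball_seq b.
Proof.
move=> wl wx x_mid; apply/negP; rewrite /ball_seq mem_cat => /orP[|xl]; last first.
  by have := tight_no_leaf_edges wl xl; rewrite wx.
rewrite inE (negbTE x_mid) orbF => /eqP xv.
have : w \in nbrs v by rewrite -edge_nbrs edge_sym -xv.
have := ball_uniq b; rewrite -[_ :: _]/(v :: [:: mid0 b; mid1 b; mid2 b] ++ leaves b).
rewrite cons_uniq cat_uniq => /and4P[_ _ /hasPn /(_ w wl) w_mid _].
by rewrite (nbrs_root b); apply/negP.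
Qed.

Lemma third_nbr (x a c : G) : edge x a -> edge x c -> a != c ->
  exists2 d, uniq [:: a; c; d] & nbrs x =i [:: a; c; d].
Proof.
move=> xa xc ac; have [p [q [U N]]] := cubic_nbrs1 G_cubic xa.
move: xc; rewrite edge_nbrs N !inE eq_sym (negbTE ac) /= => /orP[] /eqP->.
  by exists q.
exists p; first by move: U; rewrite /= !inE !negb_or !andbT (eq_sym q p) => /andP[/andP[-> ->] ->].
by move=> y; rewrite N !inE [(y == p) || _]orbC.
Qed.

Lemma leaf0_nbr_notin (b : ball v) (x : G) :
  edge (leaf0 b) x -> x != mid0 b -> x \notin ball_seq b.
Proof.
move=> wx xm; apply: (leaf_nbr_notin (w := leaf0 b)) => //; first by rewrite !inE eqxx.
have [[m00 _ _ _ _ _] [[m10 _ _ _ _ _] [m20 _ _ _ _ _]]] := mid_edges b.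
rewrite !inE (negbTE xm) /= negb_or; apply/andP; split; apply: contraTneq wx => ->.
  by rewrite edge_sym m10.
by rewrite edge_sym m20.
Qed.

Lemma leaf23_nbr_notin (b : ball v) (w x : G) : w \in [:: leaf2 b; leaf3 b] ->
  edge w x -> x != mid1 b -> x \notin ball_seq b.
Proof.
move=> wl wx xm; apply: (leaf_nbr_notin (w := w)) => //.
  by move: wl; rewrite !inE => /orP[] ->; rewrite ?orbT.
have [[_ _ m02 m03 _ _] [_ [_ _ m22 m23 _ _]]] := mid_edges b.
rewrite !inE (negbTE xm) /= negb_or; apply/andP; split; apply: contraTneq wx => ->;
  by rewrite edge_sym; move: wl; rewrite !inE => /orP[] /eqP->; rewrite ?m02 ?m03 ?m22 ?m23.
Qed.

Lemma heawood_of_vertex_sum_eq0_not_strict : heawood_at v.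
Proof.
have [b0] := ball_exists no_triangle no_square G_cubic v.
have edge_m0 : edge (mid0 b0) (leaf0 b0) by rewrite edge_nbrs nbrs_mid0 !inE eqxx ?orbT.
have [x1 [x2 [Ux N0]]] := cubic_nbrs1 G_cubic (etrans (edge_sym _ _) edge_m0).
have w0x1 : edge (leaf0 b0) x1 by rewrite edge_nbrs N0 !inE eqxx ?orbT.
have w0x2 : edge (leaf0 b0) x2 by rewrite edge_nbrs N0 !inE eqxx ?orbT.
have x1_neq_m : x1 != mid0 b0 by move: Ux; rewrite /= !inE negb_or eq_sym; case/andP=> /andP[].
have x2_neq_m : x2 != mid0 b0 by move: Ux; rewrite /= !inE negb_or (eq_sym x2); case/andP=> /andP[].
have x12 : x1 != x2 by move: Ux; rewrite /= !inE; case/and3P.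
(* By transversality [x1] sees one leaf of each other pair; swapping labels inside the pairs makes
   these leaves 2 and 4. *)
have [b [b_leaf0 b_mid0 x1w2 x1w4]] : exists b : ball v,
    [/\ leaf0 b = leaf0 b0, mid0 b = mid0 b0, edge x1 (leaf2 b) & edge x1 (leaf4 b)].
  have x1_ball := leaf0_nbr_notin w0x1 x1_neq_m.
  have x1_leaf : has (edge x1) (leaves b0) by rewrite /= edge_sym w0x1.
  have /and3P[_ T1 T2] := tight_transversal x1_ball x1_leaf.
  have [b1 [E0 E1 E2 E4 E5]] : exists b1 : ball v, [/\ leaf0 b1 = leaf0 b0,
      mid0 b1 = mid0 b0, edge x1 (leaf2 b1), leaf4 b1 = leaf4 b0 & leaf5 b1 = leaf5 b0].
    have [x1w2|x1w2] := boolP (edge x1 (leaf2 b0)); first by exists b0.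
    have [b' [? ? E2 ? ? ?] ?] := swap_leaves23 b0.
    by exists b'; split; rewrite // E2; move: T1; rewrite (negbTE x1w2).
  have [x1w4|x1w4] := boolP (edge x1 (leaf4 b1)); first by exists b1.
  have [b' [? ? ? ? E4' ?] ?] := swap_leaves45 b1.
  exists b'; split; try congruence.
  by rewrite E4' E5; move: T2; rewrite -E4 (negbTE x1w4).
rewrite -{}b_leaf0 -{}b_mid0 in edge_m0 Ux N0 w0x1 w0x2 x1_neq_m x2_neq_m.
clear b0.
have x1_ball := leaf0_nbr_notin w0x1 x1_neq_m.
have x2_ball := leaf0_nbr_notin w0x2 x2_neq_m.
have leaf_edge (x w : G) : w \in leaves b -> edge w x -> has (edge x) (leaves b).
  by move=> wl wx; apply/hasP; exists w; rewrite // edge_sym.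
have mem_leaf i : (i < 6)%N -> nth v (leaves b) i \in leaves b by move=> i6; apply: mem_nth.
have /and3P[_ T1_2 _] := tight_transversal x1_ball (leaf_edge _ _ (mem_leaf 0%N isT) w0x1).
have /and3P[_ T2_2 T2_4] := tight_transversal x2_ball (leaf_edge _ _ (mem_leaf 0%N isT) w0x2).
have w02 : leaf0 b != leaf2 b by ball_distinct b.
have w04 : leaf0 b != leaf4 b by ball_distinct b.
have w24 : leaf2 b != leaf4 b by ball_distinct b.
have w35 : leaf3 b != leaf5 b by ball_distinct b.
(* Two outer vertices with a common leaf have no other. As [x1] and [x2] share leaf 0, [x2] must see
   leaves 3 and 5. *)
have share (x y w w' : G) : x != y -> w != w' -> edge x w -> edge y w -> edge x w' ->
    edge y w' = false.
  move=> xy ww' xw yw xw'; apply: contraNF ww' => yw'; apply/eqP.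
  exact: no_square xy xw xw' yw yw'.
have x1w0 : edge x1 (leaf0 b) by rewrite edge_sym.
have x2w0 : edge x2 (leaf0 b) by rewrite edge_sym.
have x2w3 : edge x2 (leaf3 b) by move: T2_2; rewrite (share _ _ _ _ x12 w02 x1w0 x2w0 x1w2).
have x2w5 : edge x2 (leaf5 b) by move: T2_4; rewrite (share _ _ _ _ x12 w04 x1w0 x2w0 x1w4).
have x1w3 : edge x1 (leaf3 b) = false by move: T1_2; rewrite x1w2; case: (edge x1 _).
have x2w2 : edge x2 (leaf2 b) = false by move: T2_2; rewrite x2w3; case: (edge x2 (leaf2 b)).
have notin_neq x y : x \notin ball_seq b -> y \in ball_seq b -> y != x.
  by move=> xb yb; apply: contraNneq xb => <-.
have m1_ball : mid1 b \in ball_seq b by rewrite !inE eqxx ?orbT.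
have m0_ball : mid0 b \in ball_seq b by rewrite !inE eqxx ?orbT.
have w2m1 : edge (leaf2 b) (mid1 b) by rewrite edge_sym edge_nbrs nbrs_mid1 !inE eqxx ?orbT.
have w3m1 : edge (leaf3 b) (mid1 b) by rewrite edge_sym edge_nbrs nbrs_mid1 !inE eqxx ?orbT.
have w2x1 : edge (leaf2 b) x1 by rewrite edge_sym.
have w3x2 : edge (leaf3 b) x2 by rewrite edge_sym.
(* The other two outer vertices are the third neighbours of leaves 2 and 3. *)
have [x3 U3 N2] := third_nbr w2m1 w2x1 (notin_neq _ _ x1_ball m1_ball).
have [x4 U4 N3] := third_nbr w3m1 w3x2 (notin_neq _ _ x2_ball m1_ball).
have w2x3 : edge (leaf2 b) x3 by rewrite edge_nbrs N2 !inE eqxx ?orbT.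
have w3x4 : edge (leaf3 b) x4 by rewrite edge_nbrs N3 !inE eqxx ?orbT.
have x3_ball : x3 \notin ball_seq b.
  apply: leaf23_nbr_notin w2x3 _; first by rewrite !inE eqxx.
  by move: U3; rewrite /= !inE negb_or (eq_sym x3); case/andP=> /andP[].
have x4_ball : x4 \notin ball_seq b.
  apply: leaf23_nbr_notin w3x4 _; first by rewrite !inE eqxx ?orbT.
  by move: U4; rewrite /= !inE negb_or (eq_sym x4); case/andP=> /andP[].
have /and3P[T3_0 T3_2 T3_4] := tight_transversal x3_ball (leaf_edge _ _ (mem_leaf 2%N isT) w2x3).
have /and3P[T4_0 _ T4_4] := tight_transversal x4_ball (leaf_edge _ _ (mem_leaf 3%N isT) w3x4).
have x3w2 : edge x3 (leaf2 b) by rewrite edge_sym.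
have x4w3 : edge x4 (leaf3 b) by rewrite edge_sym.
have x13 : x1 != x3 by move: U3; rewrite /= !inE; case/and3P.
have x24 : x2 != x4 by move: U4; rewrite /= !inE; case/and3P.
have x23 : x2 != x3 by apply: contraTneq x3w2 => <-; rewrite x2w2.
have x14 : x1 != x4 by apply: contraTneq x4w3 => <-; rewrite x1w3.
have x3w3 : edge x3 (leaf3 b) = false by move: T3_2; rewrite x3w2; case: (edge x3 (leaf3 b)).
have x34 : x3 != x4 by apply: contraTneq x4w3 => <-; rewrite x3w3.
have not_w0 x : x \notin ball_seq b -> x1 != x -> x2 != x -> edge x (leaf0 b) = false.
  move=> xb x1x x2x; rewrite edge_sym edge_nbrs N0 !inE ![x == _]eq_sym.
  by rewrite (negbTE x1x) (negbTE x2x) (negbTE (notin_neq _ _ xb m0_ball)).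
(* The neighbourhood of leaf 0 is full, so [x3] and [x4] see leaf 1. Next, [x3] shares leaf 2 with
   [x1] and [x4] shares leaf 3 with [x2], which settles the last pair. *)
have x3w1 : edge x3 (leaf1 b) by move: T3_0; rewrite not_w0.
have x4w1 : edge x4 (leaf1 b) by move: T4_0; rewrite not_w0.
have x3w5 : edge x3 (leaf5 b) by move: T3_4; rewrite (share _ _ _ _ x13 w24 x1w2 x3w2 x1w4).
have x4w4 : edge x4 (leaf4 b).
  by move: T4_4; rewrite (share _ _ _ _ x24 w35 x2w3 x4w3 x2w5) addbF.
(* With v the point 0 of the cyclic model, the lines through v are 0, 6 and 4, and
   x1, x2, x3, x4 are the lines {1,2,4}, {5,6,1}, {2,3,5}, {3,4,6}. *)
pose pts := [:: v; leaf0 b; leaf2 b; leaf1 b; leaf4 b; leaf5 b; leaf3 b].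
pose lns := [:: mid0 b; x1; x3; x4; mid2 b; x2; mid1 b].
have U : uniq (pts ++ lns).
  have : uniq (ball_seq b ++ [:: x1; x2; x3; x4]).
    rewrite cat_uniq; apply/and3P; split; first exact: ball_uniq b.
      by apply/hasPn => x; rewrite 4!in_cons in_nil orbF => /or4P[] /eqP->.
    by rewrite /= !inE !negb_or x12 x13 x14 x23 x24 x34.
  rewrite (_ : uniq _ = uniq (pts ++ lns)) //; apply: perm_uniq.
  by apply/permP => a; rewrite /= ; ring.
(* Lines occupy the positions from 7 on; all indices are below 14, so the default [v] is never
   returned. *)
pose f (h : heawood) : G :=
  nth v (pts ++ lns) match h with inl p => val p | inr l => 7 + val l end.
have f_inj : injective f.
  move=> h h' /eqP; rewrite nth_uniq //; last 2 first.
  - by case: h => -[[|[|[|[|[|[|[|//]]]]]]] ?].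
  - by case: h' => -[[|[|[|[|[|[|[|//]]]]]]] ?].
  case: h h' => x [] y /eqP E.
  - by congr inl; apply: val_inj.
  - by have := ltn_ord x; rewrite E.
  - by have := ltn_ord y; rewrite -E.
  - by congr inr; apply: val_inj; apply: addnI E.
exists f; split=> //; apply: hom_embedding => // p l.
have vm0 : edge v (mid0 b) by rewrite edge_nbrs (nbrs_root b) !inE eqxx.
have vm1 : edge v (mid1 b) by rewrite edge_nbrs (nbrs_root b) !inE eqxx orbT.
have vm2 : edge v (mid2 b) by rewrite edge_nbrs (nbrs_root b) !inE eqxx !orbT.
have [[m0w0 m0w1 _ _ _ _] [[_ _ m1w2 m1w3 _ _] [_ _ _ _ m2w4 m2w5]]] := mid_edges b.
case: p l => -[|[|[|[|[|[|[|//]]]]]]] ? [] [|[|[|[|[|[|[|//]]]]]]] ? // _;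
  rewrite /f /=; first [assumption | rewrite edge_sym; assumption].
Qed.

End Reconstruction.

(** * Short cycles: the girth hypothesis, and the Heawood graph *)

Lemma girth_ge5_no_triangle (G : sgraph) : girth_ge5 G ->
  forall x y z : G, edge x y -> edge x z -> ~~ edge y z.
Proof.
move=> [no3 _] x y z xy xz; apply/negP => yz; apply: no3.
exists [:: x; y; z] => //; rewrite /ucycle /= xy yz (edge_sym z) xz /= !inE.
have irr (a b : G) : edge a b -> a == b = false by move/edge_neq/negbTE.
by rewrite !irr.
Qed.

Lemma girth_ge5_no_square (G : sgraph) : girth_ge5 G ->
  forall x y a b : G, x != y -> edge x a -> edge x b -> edge y a -> edge y b -> a = b.
Proof.
move=> [_ no4] x y a b xy xa xb ya yb; apply/eqP/negPn/negP => ab; apply: no4.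
exists [:: x; a; y; b] => //.
rewrite /ucycle /= xa yb (edge_sym a) ya (edge_sym b) xb /= !inE !negb_or xy ab.
have irr (c d : G) : edge c d -> c == d = false by move/edge_neq/negbTE.
by rewrite [a == y]eq_sym !irr.
Qed.

Lemma heawood_cubic : cubic heawood.
Proof.
move=> x; have -> : [set y | edge x y] = [set y in heawood_nbrs x].
  by apply/setP => y; rewrite !inE heawood_edgeE.
by rewrite cardsE (card_uniqP (heawood_nbrs_uniq x)); case: x.
Qed.

Lemma heawood_no_triangle (x y z : heawood) : edge x y -> edge x z -> ~~ edge y z.
Proof. by case: x y z => x [] y [] z. Qed.

Lemma heawood_no_square (x y a b : heawood) : x != y ->
  edge x a -> edge x b -> edge y a -> edge y b -> a = b.
Proof.
(* Only [x] is split into 14 cases; the other vertices run through neighbour lists. *)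
have squares : all (fun a => all (fun y => (x != y) ==>
    all (fun b => (b \in heawood_nbrs y) ==> (a == b)) (heawood_nbrs x))
    (heawood_nbrs a)) (heawood_nbrs x).
  by case: x => -[[|[|[|[|[|[|[|//]]]]]]] ?]; vm_compute.
move=> xy; rewrite (edge_sym y a) !heawood_edgeE => xa xb ay yb.
have /allP /(_ y ay) /implyP /(_ xy) := allP squares a xa.
by move=> /allP /(_ b xb) /implyP /(_ yb) /eqP.
Qed.

(** * The extremal bound and the case of equality *)

Section Extremality.
Variables (R : realType) (G : sgraph) (lambda : R).
Hypothesis no_triangle : forall x y z : G, edge x y -> edge x z -> ~~ edge y z.
Hypothesis no_square : forall x y a b : G, x != y ->
  edge x a -> edge x b -> edge y a -> edge y b -> a = b.
Hypothesis G_cubic : cubic G.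
Hypothesis G_nonempty : (0 < #|G|)%N.
Hypothesis lambda_gt0 : 0 < lambda.

Let vertex_le0 (v : G) : vertex_sum lambda v <= 0.
Proof.
have [b] := ball_exists no_triangle no_square G_cubic v.
exact: vertex_sum_le0.
Qed.

Let unit_gt0 : 0 < evalp lambda unitp.
Proof. exact: evalp_gt0. Qed.

Let scale_gt0 : 0 < #|G|%:R * (indep_poly R G).[lambda].
Proof. by rewrite mulr_gt0 ?ltr0n ?indep_poly_gt0. Qed.

Lemma occupancy_le : occupancy G lambda <= evalp lambda valuep / evalp lambda unitp.
Proof.
rewrite ler_pdivlMr // mulrC -subr_le0.
have : \sum_(v : G) vertex_sum lambda v <= 0 by apply: sumr_le0.
by rewrite sum_vertex_sum // pmulrn_lle0 // pmulr_lle0.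
Qed.

(** The bound is attained exactly when the nonpositive vertex sums add up to zero, that is, when
    each of them vanishes. *)
Lemma occupancy_eq :
  occupancy G lambda = evalp lambda valuep / evalp lambda unitp <->
  forall v : G, heawood_at v.
Proof.
have -> : occupancy G lambda = evalp lambda valuep / evalp lambda unitp <->
    \sum_(v : G) vertex_sum lambda v = 0.
  rewrite sum_vertex_sum //; split=> [->|].
    by rewrite [evalp _ unitp * _]mulrC divfK ?gt_eqF // subrr mul0r mul0rn.
  move/eqP; rewrite mulrn_eq0 /= mulf_eq0 (gt_eqF scale_gt0) orbF subr_eq0 mulrC.
  by move/eqP <-; rewrite mulfK // gt_eqF.
split=> [sum0 v|at_all].
  apply: (heawood_of_vertex_sum_eq0_not_strict no_triangle no_square G_cubic lambda_gt0).
  have term_ge0 (w : G) : true -> 0 <= - vertex_sum lambda w.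
    by rewrite oppr_ge0.
  have := psumr_eq0P term_ge0; rewrite sumrN sum0 oppr0 => /(_ erefl v isT) /eqP.
  by rewrite oppr_eq0 => /eqP.
by apply: big1 => v _; apply: heawood_vertex_sum.
Qed.

End Extremality.

Theorem theorem5 (R : realType) (G : sgraph) (lambda : R)
    (G_nonempty : (0 < #|G|)%N) (G_cubic : cubic G) (G_girth : girth_ge5 G)
    (lambda_gt0 : 0 < lambda) :
  occupancy G lambda <= occupancy heawood lambda /\
  (occupancy G lambda = occupancy heawood lambda <->
   union_of_copies heawood G).
Proof.
have no_triangle := girth_ge5_no_triangle G_girth.
have no_square := girth_ge5_no_square G_girth.
have heawood_nonempty : (0 < #|heawood|)%N by apply/card_gt0P; exists (point 0).
(* The equality criterion applied to the Heawood graph itself gives its occupancy fraction, without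
   computing its independence polynomial. *)
have -> : occupancy heawood lambda = evalp lambda valuep / evalp lambda unitp.
  apply/(occupancy_eq heawood_no_triangle heawood_no_square heawood_cubic) => // h.
  exact: heawood_transitive.
split; first exact: occupancy_le.
rewrite (occupancy_eq no_triangle no_square) //.
split=> [at_all v|copies v].
  exact: heawood_at_component.
exact/component_heawood_at/copies.
Qed.
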